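(* Let $\ell\ge3$, let $\widetilde C$ be an orientation of $C_\ell$ that is not a directed cycle, let $0<\mu\le10^{-2}$, let $0<\eta\ll\mu$, $0<d\ll\mu^2$, $0<\varepsilon\ll d^4,\mu^2,1/\ell$, let $M\ge M_0>3$ be integers, let $\xi>0$, let $\gamma>0$ be sufficiently small in terms of all preceding constants, and let $n_0$ be sufficiently large in terms of all of these. Let $D$ be an oriented graph of order $n\ge n_0$ with $\sigma_{\mathrm{Ore}}^*(D)\ge(\frac34+\mu)n$ and $\alpha(D)\le\gamma n$. Take an $(\varepsilon,d)$-regularity partition $V_0,V_1,\dots,V_k$ of $D$ with pure digraph $D'$, a partner map $f$ with bad set $E_{\mathrm{bad}}$, and an exceptional tiling $\mathcal F_E$, and put $D_1:=D-V(\mathcal F_E)$. Let $A\subseteq V(D_1)$ be any subset with $|A|\le\eta n$ and put $D_2:=D_1-A$. Then $D_2$ admits a $\widetilde C$-tiling leaving at most $\xi n$ vertices of $D_2$ uncovered.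
   Context: Notation $a\ll b$: $a$ is chosen sufficiently small in terms of $b$ (i.e. there is a positive function $\phi$ such that the statement holds whenever $0<a\le\phi(b)$). An oriented graph is a finite loopless digraph with at most one arc between any two vertices. $\alpha(D)$ is the independence number of the underlying undirected graph. $d_D^*(v):=\max\{d_D^+(v),d_D^-(v)\}$, and $\sigma_{\mathrm{Ore}}^*(D):=\min\{d_D^*(x)+d_D^*(y):x\ne y,\ xy,yx\notin A(D)\}$ (here $A(D)$ is the arc set), with value $\infty$ if the underlying graph is complete. $P^+:=\{v\in V(D):d_D^+(v)\ge d_D^-(v)\}$, $P^-:=V(D)\setminus P^+$ (either may be empty). A $\widetilde C$-tiling is a set of pairwise vertex-disjoint copies of $\widetilde C$; $V(\mathcal F)$ is the set of vertices it covers. For disjoint vertex sets $X,Y$, $d_{D'}(X,Y)$ is the number of arcs of $D'$ from $X$ to $Y$ divided by $|X||Y|$; $(X,Y)$ is $\varepsilon$-regular if $|d_{D'}(X',Y')-d_{D'}(X,Y)|<\varepsilon$ for all $X'\subseteq X$, $Y'\subseteq Y$ with $|X'|\ge\varepsilon|X|$, $|Y'|\ge\varepsilon|Y|$. An $(\varepsilon,d)$-regularity partition of $D$ with pure digraph $D'$ is a partition $V(D)=V_0\cup V_1\cup\dots\cup V_k$ and a spanning subdigraph $D'\subseteq D$ such that: $M_0\le k\le M$, $|V_0|\le\varepsilon n$, $|V_1|=\dots=|V_k|=:m$; each $V_i$, $i\in[k]$, is contained in $P^+$ or in $P^-$; $D'[V_i]$ has no arcs for each $i\in[k]$ and all vertices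 of $V_0$ are isolated in $D'$; $d_{D'}^{\pm}(v)\ge d_D^{\pm}(v)-(d+2\varepsilon)n$ for every $v\in V(D)\setminus V_0$; for all distinct $i,j\in[k]$, $(V_i,V_j)$ is $\varepsilon$-regular in $D'$ with density $p_{(i,j)}:=d_{D'}(V_i,V_j)$ either $0$ or at least $d$. A partner map is a map $f:[k]\to[k]$ with $f(i)\ne i$ such that $p_{(i,f(i))}\ge d$ whenever $V_i\subseteq P^+$ and $p_{(f(i),i)}\ge d$ whenever $V_i\subseteq P^-$ (such a map exists under the stated hypotheses). Put $B_i:=\{x\in V_i:d_{D'}^+(x,V_{f(i)})<(p_{(i,f(i))}-\varepsilon)m\}$ if $V_i\subseteq P^+$, and $B_i:=\{x\in V_i:d_{D'}^-(x,V_{f(i)})<(p_{(f(i),i)}-\varepsilon)m\}$ if $V_i\subseteq P^-$. The bad set is $E_{\mathrm{bad}}:=V_0\cup\bigcup_iB_i$. An exceptional tiling is a $\widetilde C$-tiling $\mathcal F_E$ of $D$ such that every copy in it contains exactly one vertex of $E_{\mathrm{bad}}$, $E_{\mathrm{bad}}\subseteq V(\mathcal F_E)$, $|V(\mathcal F_E)|=\ell|E_{\mathrm{bad}}|\le2\ell\varepsilon n\le\sqrt\varepsilon n$, and $|V(\mathcal F_E)\cap V_i|\le3\sqrt\varepsilon m$ for every $i\in[k]$ (such a tiling exists under the stated hypotheses). *)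

(* Defs.v *)
From mathcomp Require Import all_boot all_order all_algebra.
From mathcomp Require Import reals constructive_ereal.

Set Implicit Arguments.
Unset Strict Implicit.
Unset Printing Implicit Defensive.

Import Order.TTheory GRing.Theory Num.Theory.
Local Open Scope ring_scope.

(* A digraph on the finite vertex set T is its arc relation D : rel T. *)

Definition oriented (T : finType) (D : rel T) : Prop :=
  irreflexive D /\ forall x y, ~~ (D x y && D y x).

Definition stable (T : finType) (D : rel T) (S : {set T}) : bool :=
  [forall x in S, forall y in S, ~~ D x y].

Definition indep_num (T : finType) (D : rel T) : nat :=
  \max_(S : {set T} | stable D S) #|S|.

Definition outdeg_in (T : finType) (D : rel T) (x : T) (Y : {set T}) : nat :=
  #|[set y in Y | D x y]|.

Definition indeg_in (T : finType) (D : rel T) (x : T) (Y : {set T}) : nat :=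
  #|[set y in Y | D y x]|.

Definition outdeg (T : finType) (D : rel T) (x : T) : nat :=
  outdeg_in D x [set: T].

Definition indeg (T : finType) (D : rel T) (x : T) : nat :=
  indeg_in D x [set: T].

Definition degstar (T : finType) (D : rel T) (x : T) : nat :=
  maxn (outdeg D x) (indeg D x).

(* Valued in \bar R: the minimum over the empty set of pairs is +oo. *)
Definition sigma_ore (R : realType) (T : finType) (D : rel T) : \bar R :=
  \big[Order.min/+oo%E]_(p : T * T |
      [&& p.1 != p.2, ~~ D p.1 p.2 & ~~ D p.2 p.1])
    ((degstar D p.1 + degstar D p.2)%:R)%:E.

Definition Pplus (T : finType) (D : rel T) : {set T} :=
  [set v | (indeg D v <= outdeg D v)%N].

Definition Pminus (T : finType) (D : rel T) : {set T} := ~: Pplus D.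

(* C_l has vertex set 'I_l and edges {i, i + 1 mod l} (ordS i is i + 1 mod l);
   this is a cycle, with l distinct edges, only for l >= 3. *)
Definition cycle_orientation (l : nat) (C : rel 'I_l) : Prop :=
  oriented C /\
  forall i j, (C i j || C j i) = ((j == ordS i) || (i == ordS j)).

Definition directed_cycle (l : nat) (C : rel 'I_l) : Prop :=
  (forall i, C i (ordS i)) \/ (forall i, C (ordS i) i).

(* A copy of C in D is given by an embedding. Copies in a tiling are pairwise
   vertex-disjoint, so a set of embeddings with pairwise disjoint images is a
   set of pairwise vertex-disjoint subdigraphs isomorphic to C, each with a
   chosen parametrization. *)
Definition embedding (l : nat) (C : rel 'I_l) (T : finType) (D : rel T)
    (phi : {ffun 'I_l -> T}) : Prop :=
  injective phi /\ forall i j, C i j -> D (phi i) (phi j).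

Definition copy_verts (l : nat) (T : finType) (phi : {ffun 'I_l -> T}) :
    {set T} :=
  [set phi i | i : 'I_l].

Definition tiling_verts (l : nat) (T : finType)
    (F : {set {ffun 'I_l -> T}}) : {set T} :=
  \bigcup_(phi in F) copy_verts phi.

(* F is a C-tiling of the induced subdigraph D[W]. *)
Definition tiling (l : nat) (C : rel 'I_l) (T : finType) (D : rel T)
    (W : {set T}) (F : {set {ffun 'I_l -> T}}) : Prop :=
  [/\ forall phi, phi \in F -> embedding C D phi,
      forall phi, phi \in F -> copy_verts phi \subset W &
      forall phi psi, phi \in F -> psi \in F -> phi != psi ->
        [disjoint copy_verts phi & copy_verts psi]].

Definition density (R : realType) (T : finType) (D : rel T)
    (X Y : {set T}) : R :=
  #|[set p in setX X Y | D p.1 p.2]|%:R / (#|X|%:R * #|Y|%:R).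

Definition eps_regular (R : realType) (T : finType) (D : rel T) (eps : R)
    (X Y : {set T}) : Prop :=
  forall X' Y' : {set T}, X' \subset X -> Y' \subset Y ->
    eps * #|X|%:R <= #|X'|%:R -> eps * #|Y|%:R <= #|Y'|%:R ->
    `|density R D X' Y' - density R D X Y| < eps.

Definition vertex_partition (T : finType) (k : nat) (V0 : {set T})
    (V : 'I_k -> {set T}) : Prop :=
  [/\ V0 :|: \bigcup_i V i = [set: T],
      forall i, [disjoint V0 & V i] &
      forall i j, i != j -> [disjoint V i & V j]].

(* D' is the pure digraph, m the common size of the clusters V i; the index
   set [k] is 'I_k and the exceptional class V0 is kept apart. *)
Record regularity_partition (R : realType) (T : finType) (D : rel T)
    (eps d : R) (M0 M k m : nat) (V0 : {set T}) (V : 'I_k -> {set T})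
    (D' : rel T) : Prop := RegularityPartition {
  rp_partition : vertex_partition V0 V;
  rp_subdigraph : subrel D' D;
  rp_number : (M0 <= k <= M)%N;
  rp_exceptional : #|V0|%:R <= eps * #|T|%:R;
  rp_size : forall i, #|V i| = m;
  rp_refine : forall i, (V i \subset Pplus D) || (V i \subset Pminus D);
  rp_stable : forall i, stable D' (V i);
  rp_isolated : forall v u, v \in V0 -> ~~ D' v u && ~~ D' u v;
  rp_outdeg : forall v, v \notin V0 ->
    (outdeg D v)%:R - (d + 2 * eps) * #|T|%:R <= (outdeg D' v)%:R;
  rp_indeg : forall v, v \notin V0 ->
    (indeg D v)%:R - (d + 2 * eps) * #|T|%:R <= (indeg D' v)%:R;
  rp_regular : forall i j, i != j -> eps_regular D' eps (V i) (V j);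
  rp_density : forall i j, i != j ->
    density R D' (V i) (V j) = 0 \/ d <= density R D' (V i) (V j)
}.

Definition partner_map (R : realType) (T : finType) (D : rel T) (d : R)
    (k : nat) (V : 'I_k -> {set T}) (D' : rel T) (f : 'I_k -> 'I_k) : Prop :=
  forall i, [/\ f i != i,
    V i \subset Pplus D -> d <= density R D' (V i) (V (f i)) &
    V i \subset Pminus D -> d <= density R D' (V (f i)) (V i)].

(* In a regularity partition, a cluster not contained in Pplus D is contained
   in Pminus D. *)
Definition bad_in (R : realType) (T : finType) (D : rel T) (eps : R)
    (k m : nat) (V : 'I_k -> {set T}) (D' : rel T) (f : 'I_k -> 'I_k)
    (i : 'I_k) : {set T} :=
  if V i \subset Pplus D then
    [set x in V i | (outdeg_in D' x (V (f i)))%:R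
                      < (density R D' (V i) (V (f i)) - eps) * m%:R]
  else
    [set x in V i | (indeg_in D' x (V (f i)))%:R
                      < (density R D' (V (f i)) (V i) - eps) * m%:R].

Definition bad_set (R : realType) (T : finType) (D : rel T) (eps : R)
    (k m : nat) (V0 : {set T}) (V : 'I_k -> {set T}) (D' : rel T)
    (f : 'I_k -> 'I_k) : {set T} :=
  V0 :|: \bigcup_i bad_in D eps m V D' f i.

Record exceptional_tiling (R : realType) (l : nat) (C : rel 'I_l)
    (T : finType) (D : rel T) (eps : R) (k m : nat) (V : 'I_k -> {set T})
    (E : {set T}) (F : {set {ffun 'I_l -> T}}) : Prop := ExceptionalTiling {
  et_tiling : tiling C D [set: T] F;
  et_one_bad : forall phi, phi \in F -> #|copy_verts phi :&: E| = 1%N;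
  et_cover : E \subset tiling_verts F;
  et_card : #|tiling_verts F| = (l * #|E|)%N;
  et_card_le : (l * #|E|)%:R <= 2 * l%:R * eps * #|T|%:R;
  et_card_le_sqrt : 2 * l%:R * eps * #|T|%:R <= Num.sqrt eps * #|T|%:R;
  et_cluster : forall i,
    #|tiling_verts F :&: V i|%:R <= 3 * Num.sqrt eps * m%:R
}.

(* Main.v *)
Require Import Defs.
From mathcomp Require Import all_boot all_order all_algebra.
From mathcomp Require Import reals constructive_ereal boolp zify lra.

Set Implicit Arguments.
Unset Strict Implicit.
Unset Printing Implicit Defensive.

Import Order.TTheory GRing.Theory Num.Theory.
Local Open Scope ring_scope.

(* Let F be a tiling of the remaining vertex set with as many copies as possible
   and let L be the set of uncovered vertices. Since D has small independence
   number, every not too small set of vertices contains every orientation of the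
   path on l - 1 vertices. As C has both a source and a sink, a vertex with many
   neighbours in L therefore lies in a copy whose other vertices are in L. By
   maximality of F, L spans few arcs, and each copy in F has at most one vertex
   with many neighbours in L. So there are at most about |F||L| <= n|L|/l <=
   n|L|/3 adjacent pairs between L and the covered vertices. On the other hand
   L is sparse, so the Ore condition gives nearly all its vertices degree at
   least 3n/8, and all but a small proportion of n of these neighbours are
   covered. As 3/8 > 1/3, L must be small. *)

(** The Boolean lets sources and sinks, and out- and in-neighbourhoods, be treated by one
    argument. *)
Definition arr (T : Type) (b : bool) (D : rel T) (x y : T) : bool :=
  if b then D x y else D y x.

Definition adj (T : Type) (D : rel T) (x y : T) : bool := D x y || D y x.

(** * Oriented paths in digraphs of small independence number *)

Section OrientedPaths.
Local Open Scope nat_scope.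
Variables (T : finType) (D : rel T).
Hypothesis Dirr : irreflexive D.

Lemma large_set_arc (S : {set T}) : indep_num D < #|S| ->
  exists x y, [/\ x \in S, y \in S & D x y].
Proof.
move=> ltS; case: (boolP (stable D S)) => [stS|].
  move: ltS; rewrite ltnNge /indep_num.
  by rewrite (leq_bigmax_cond (F := fun S : {set T} => #|S|)).
rewrite negb_forall => /existsP[x]; rewrite negb_imply => /andP[xS].
rewrite negb_forall => /existsP[y]; rewrite negb_imply negbK => /andP[yS xy].
by exists x, y.
Qed.

Definition oriented_path (x0 : T) (b : nat -> bool) (r : nat) (S : {set T})
    (p : seq T) : Prop :=
  [/\ size p = r.+1, uniq p, {subset p <= S} &
      forall k, k < r -> arr (b k) D (nth x0 p k) (nth x0 p k.+1)].

(* Pairwise disjoint paths with adjacent starting points can be concatenated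
   through these points in either direction, whatever the direction of the
   arc. *)
Lemma oriented_path_exists (x0 : T) (r : nat) (b : nat -> bool) (S : {set T}) :
  r.+1 ^ 2 * (indep_num D).+1 <= #|S| -> exists p, oriented_path x0 b r S p.
Proof.
elim: r b S => [|r IHr] b S leS.
  have /card_gt0P[x xS] : 0 < #|S| by lia.
  by exists [:: x]; split=> //= y; rewrite inE => /eqP->.
(* Disjoint paths are collected greedily: [Y] holds their first vertices and [U] contains all their
   vertices. Each path meets [Y] only in its own start, so prepending another element of [Y] keeps
   it simple. At most [indep_num D] paths with [r.+1] vertices each are removed before the next
   choice, and the gap between the squares of [r.+2] and [r.+1] pays for this. *)
have families : forall t, t <= (indep_num D).+1 ->
    exists Y U : {set T}, [/\ #|Y| = t, #|U| <= t * r.+1, Y \subset U,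
      U \subset S & forall y, y \in Y -> exists p,
      [/\ oriented_path x0 (fun k => b k.+1) r U p, nth x0 p 0 = y &
          forall z, z \in Y -> z \in p -> z = y]].
  elim=> [|t IHt] let_.
    exists set0, set0; by rewrite cards0 !sub0set; split=> // y; rewrite inE.
  have [Y [U [cY cU sYU sUS pY]]] := IHt (ltnW let_).
  have [|p [szp up sp arp]] := IHr (fun k => b k.+1) (S :\: U).
    have := cardsID U S; have := subset_leq_card (subsetIr S U).
    nia.
  have p0 : nth x0 p 0 \in p by rewrite mem_nth ?szp.
  have pU z : z \in p -> z \notin U by move/sp; rewrite inE => /andP[].
  have sYp z : z \in Y -> z \notin p.
    by move=> /(subsetP sYU) zU; apply: contraL zU => /pU.
  exists (nth x0 p 0 |: Y), ([set z in p] :|: U); split.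
  - by rewrite cardsU1 cY (contraL (@sYp _)).
  - rewrite mulSn (leq_trans (leq_card_setU _ _)) // leq_add //.
    by rewrite cardsE (leq_trans (card_size p)) // szp.
  - by rewrite subUset sub1set !inE p0 /= subsetU // sYU orbT.
  - rewrite subUset sUS andbT; apply/subsetP => z; rewrite inE => /sp.
    by rewrite inE => /andP[].
  - move=> y; rewrite !inE => /orP[/eqP->|yY].
      exists p; split=> // [|z].
        by split=> // z zp; rewrite !inE zp.
      by rewrite !inE => /orP[/eqP//|/sYp/negPf->].
    have [q [[szq uq sq arq] q0 Yq]] := pY y yY.
    exists q; split=> // [|z].
      by split=> // z /sq zU; rewrite !inE zU orbT.
    rewrite !inE => /orP[/eqP->|]; last exact: Yq.
    by move/sq; rewrite (negPf (pU _ p0)).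
have [Y [U [cY _ sYU sUS pY]]] := families _ (leqnn _).
have [x [y [xY yY xy]]] : exists x y, [/\ x \in Y, y \in Y & arr (b 0) D x y].
  have [|x [y [xY yY xy]]] := @large_set_arc Y; first by rewrite cY.
  by rewrite /arr; case: (b 0); [exists x, y | exists y, x].
have neq : x != y.
  by apply: contraTneq xy => ->; rewrite /arr Dirr; case: ifP.
have [p [[szp up sp arp] p0 Yp]] := pY y yY.
exists (x :: p); split=> /=; first by rewrite szp.
- by rewrite up andbT; apply: contraNN neq => /(Yp x xY)->.
- move=> z; rewrite inE => /orP[/eqP->|/sp]; last exact: (subsetP sUS).
  by rewrite (subsetP sUS) ?(subsetP sYU).
- by case=> [|k] ltk /=; [rewrite p0 | apply: arp].
Qed.

End OrientedPaths.

(** * Sources and sinks in orientations of a cycle *)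

Lemma Zp_pred_closed (n : nat) (P : pred 'I_n.+2) (i j : 'I_n.+2) :
  (forall a, P (a + 1) -> P a) -> P i -> P j.
Proof.
move=> Pdec Pi; have Pk k : P (i - k%:R).
  elim: k => [|k IHk]; first by rewrite subr0.
  by apply: Pdec; rewrite -natr1 opprD addrA subrK.
by have := Pk (i - j); rewrite natr_Zp subKr.
Qed.

(** Without such an [i], an arc in direction [b] at [a + 1] forces one at [a], so a single arc in
    direction [b] propagates backwards round the whole cycle. If there is none, all arcs point the
    other way. Both cases give a directed cycle. The length [n.+3] makes the successor on the cycle
    addition of 1 in a ring. *)
Lemma source_or_sink (n : nat) (C : rel 'I_n.+3) (b : bool) :
  cycle_orientation C -> ~ directed_cycle C ->
  exists i, arr b C i (i + 1) /\ arr b C i (i - 1).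
Proof.
move=> [_ Cadj] Cdir.
have C1 i : adj C i (i + 1) by rewrite /adj Cadj (@add_Zp_1 n.+3) eqxx.
have arrN i j c : adj C i j -> arr c C i j || arr (~~ c) C i j.
  by rewrite /adj /arr; case: c => //=; rewrite orbC.
have [/existsP[i /andP[]]|/existsPn none] :=
  boolP [exists i, arr b C i (i + 1) && arr b C i (i - 1)]; first by exists i.
case: Cdir; have dirall c : (forall i, arr c C i (i + 1)) -> directed_cycle C.
  by rewrite /arr; case: c => H; [left | right] => i;
    rewrite -(@add_Zp_1 n.+3).
have [/existsP[i Pi]|/existsPn Pn] := boolP [exists i, arr b C i (i + 1)].
  apply: (dirall b) => j.
  apply: (@Zp_pred_closed n.+1 (fun a => arr b C a (a + 1)) i j) => [a Pa|];
    last exact: Pi.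
  move: (none (a + 1)); rewrite Pa addrK /= => /negbTE na.
  have := arrN a (a + 1) b (C1 a); case: (boolP (arr b C a (a + 1))) => //=.
  by move: na; rewrite /arr; case: (b) => /= ->.
apply: (dirall (~~ b)) => j; have := arrN j (j + 1) b (C1 j).
by rewrite (negPf (Pn j)).
Qed.

(** * Copies of the cycle inside a neighbourhood *)

Section Copies.
Local Open Scope nat_scope.
Variables (n : nat) (C : rel 'I_n.+3) (T : finType) (D : rel T).
Hypotheses (Corient : cycle_orientation C) (Cdir : ~ directed_cycle C).
Hypothesis Dirr : irreflexive D.

(* Removing a source or a sink of C leaves an oriented path, which is found
   inside the out- or in-neighbourhood of x. *)
Lemma copy_from_neighbours (b : bool) (x : T) (S : {set T}) :
  n.+2 ^ 2 * (indep_num D).+1 <= #|[set y in S | arr b D x y]| ->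
  exists2 phi : {ffun 'I_n.+3 -> T}, embedding C D phi &
    copy_verts phi \subset x |: S.
Proof.
move=> leS; have [i [i1 i2]] := source_or_sink b Corient Cdir.
(* The directions read along the cycle from [i + 1] round to [i - 1]. *)
pose c k := C (i + (k.+1)%:R)%R (i + (k.+2)%:R)%R.
have [p [szp up sp arp]] := oriented_path_exists Dirr x c leS.
have xp : x \notin p.
  apply/negP => /sp; rewrite inE /arr Dirr.
  by case: b {leS sp i1 i2}; rewrite andbF.
have arrx k : k < n.+2 -> arr b D x (nth x p k).
  move=> ltk; have := sp (nth x p k).
  by rewrite mem_nth ?szp // inE => /(_ isT)/andP[].
(* The source or sink [i] goes to [x], and the vertices after it follow [p]. *)
pose phi := [ffun j : 'I_n.+3 => nth x (x :: p) (j - i)%R].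
have szxp : size (x :: p) = n.+3 by rewrite /= szp.
(* Three cases: the arc leaving [i] along the cycle, the arc closing the cycle at [i - 1], and the
   arcs of the path. *)
have step j : arr (C j (j + 1)%R) D (phi j) (phi (j + 1)%R).
  have jE : (j = i + (nat_of_ord (j - i)%R)%:R)%R.
    by rewrite natr_Zp addrC subrK.
  have asym a a' : ~~ (C a a' && C a' a) by case: Corient => -[].
  have nth0x : nth x (x :: p) (0%R : 'I_n.+3) = x by [].
  rewrite !ffunE; move: jE; case k_eq: (nat_of_ord (j - i)%R) => [|k] jE.
    have ji : j = i by rewrite jE addr0.
    have -> : (j + 1 - i = 1)%R by rewrite ji addrAC subrr add0r.
    have := arrx 0 isT; move: i1 (asym i (i + 1)%R); rewrite -ji /arr.
    by case: (b) => /= -> //=; rewrite andbT => /negPf->.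
  have : k < n.+2 by have := ltn_ord (j - i)%R; rewrite k_eq.
  rewrite leq_eqVlt => /orP[/eqP[kn]|ltk].
    have j1 : (j + 1 = i)%R.
      by rewrite jE -addrA natr1 kn (pchar_Zp (p := n.+3)) ?addr0.
    have ji : j = (i - 1)%R by rewrite -j1 addrK.
    have := arrx k; rewrite kn => /(_ (ltnSn _)); move: i2 (asym i (i - 1)%R).
    rewrite j1 subrr nth0x -ji /arr.
    by case: (b) => /= -> //=; move=> /negPf->.
  have -> : nat_of_ord (j + 1 - i)%R = k.+2.
    rewrite addrAC (_ : j - i = k.+1%:R)%R; last by rewrite -k_eq natr_Zp.
    by rewrite natr1 (@val_Zp_nat n.+3) // modn_small.
  by rewrite jE -addrA natr1; apply: arp.
exists phi.
  split.
    move=> j1 j2; rewrite !ffunE => /eqP.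
    rewrite nth_uniq ?szxp ?ltn_ord //= ?xp // => /eqP eq12.
    by apply: (addIr (- i)%R); apply: val_inj.
  move=> j1 j2 C12; have [[Cirr Casym] Cadj] := Corient.
  have := Cadj j1 j2; rewrite C12 /= => /esym/orP[/eqP jE|/eqP jE].
    by have := step j1; rewrite (@add_Zp_1 n.+3) -jE C12.
  have := step j2; rewrite (@add_Zp_1 n.+3) -jE.
  by have := Casym j1 j2; rewrite C12 /= => /negPf->.
apply/subsetP => _ /imsetP[j _ ->]; rewrite ffunE.
have := mem_nth x (_ : (j - i)%R < size (x :: p)).
rewrite szxp => /(_ (ltn_ord _)).
rewrite inE !inE => /orP[->//|/sp]; by rewrite inE => /andP[->]; rewrite orbT.
Qed.
End Copies.

(** * Maximum tilings and exchange of copies *)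

Section Tilings.
Local Open Scope nat_scope.
Variables (l : nat) (C : rel 'I_l) (T : finType) (D : rel T) (W : {set T}).
Implicit Types F G : {set {ffun 'I_l -> T}}.

Lemma mem_copy_verts (phi : {ffun 'I_l -> T}) (i : 'I_l) :
  phi i \in copy_verts phi.
Proof. exact: imset_f. Qed.

Lemma maximum_tiling : exists2 F, tiling C D W F &
  forall G, tiling C D W G -> #|G| <= #|F|.
Proof.
have t0 : `[< tiling C D W set0 >].
  by apply/asboolP; split=> phi; rewrite inE.
case: (@arg_maxnP _ set0 (fun F => `[< tiling C D W F >]) (fun F => #|F|) t0)
  => F /asboolP tF maxF.
by exists F => // G tG; apply: maxF; apply/asboolP.
Qed.

Lemma copy_sub_tiling_verts F phi :
  phi \in F -> copy_verts phi \subset tiling_verts F.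
Proof. by move=> phiF; apply: bigcup_sup phiF. Qed.

(** New copies use only vertices left uncovered by [F] or freed by [F0], so they avoid the copies
    that stay. As [0 < l], copies are nonempty, so disjoint ones are distinct and the cardinalities
    add up. *)
Lemma tiling_exchange F F0 G : 0 < l -> tiling C D W F -> F0 \subset F ->
  tiling C D ((W :\: tiling_verts F) :|: tiling_verts F0) G ->
  tiling C D W ((F :\: F0) :|: G) /\
    #|(F :\: F0) :|: G| + #|F0| = #|F| + #|G|.
Proof.
move=> l0 [Femb FW Fdis] sF0 [Gemb GW Gdis].
have dFG phi psi : phi \in F :\: F0 -> psi \in G ->
    [disjoint copy_verts phi & copy_verts psi].
  move=> /setDP[phiF phiF0] psiG; apply: disjointWr (GW _ psiG) _.
  rewrite -setI_eq0; apply/eqP/setP => v; rewrite !inE.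
  apply/negbTE/negP => /andP[vphi /orP[/andP[/negP[]]|]].
    by apply: (subsetP (copy_sub_tiling_verts phiF)).
  move=> /bigcupP[rho rhoF0 vrho].
  have neq : phi != rho by apply: contraNneq phiF0 => ->.
  have := disjointFr (Fdis _ _ phiF (subsetP sF0 _ rhoF0) neq) vphi.
  by rewrite vrho.
split; last first.
  have dis : (F :\: F0) :&: G = set0.
    apply/setP => phi; rewrite in_setI in_set0; apply/negP => /andP[phiF phiG].
    have v : phi (Ordinal l0) \in copy_verts phi by apply: imset_f.
    by have := disjointFr (dFG _ _ phiF phiG) v; rewrite v.
  rewrite cardsU dis cards0 subn0 addnAC cardsD (setIidPr sF0).
  by rewrite subnK ?subset_leq_card.
split=> [phi|phi|phi psi].
- by rewrite inE => /orP[/setDP[/Femb]|/Gemb].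
- rewrite inE => /orP[/setDP[/FW//]|/GW/subset_trans]; apply.
  rewrite subUset subsetDl; apply/bigcupsP => rho /(subsetP sF0); exact: FW.
- rewrite !in_setU => /orP[p|p] /orP[q|q] neq.
  + by move: p q => /setDP[p _] /setDP[q _]; apply: Fdis.
  + exact: dFG.
  + by rewrite disjoint_sym; apply: dFG.
  + exact: Gdis.
Qed.

Lemma card_tiling F : tiling C D W F -> #|F| * l <= #|T|.
Proof.
move=> [Femb _ Fdis].
have -> : #|F| * l = #|setX F [set: 'I_l]| by rewrite cardsX cardsT card_ord.
have inj : {in setX F [set: 'I_l] &,
    injective (fun p : {ffun 'I_l -> T} * 'I_l => p.1 p.2)}.
  move=> [phi i] [psi j]; rewrite !inE /= !andbT => phiF psiF eq_ij.
  have [eq|neq] := eqVneq phi psi.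
    by move: eq_ij; rewrite eq => /(proj1 (Femb _ psiF))->.
  have := disjointFr (Fdis _ _ phiF psiF neq) (mem_copy_verts phi i).
  by rewrite eq_ij mem_copy_verts.
by rewrite -(card_in_imset inj) max_card.
Qed.

End Tilings.

(** * Degrees in the underlying graph *)

Section Degrees.
Local Open Scope nat_scope.
Variables (T : finType) (D : rel T).

Definition adjdeg (x : T) (S : {set T}) : nat := #|[set y in S | adj D x y]|.

Lemma adjdeg_sum x S : adjdeg x S = \sum_(y in S) adj D x y.
Proof.
rewrite /adjdeg -sum1_card big_mkcond [RHS]big_mkcond /=.
by apply: eq_bigr => y _; rewrite inE; case: (y \in S); case: adj.
Qed.

Lemma adjdeg_arr x S : adjdeg x S <=
  #|[set y in S | arr true D x y]| + #|[set y in S | arr false D x y]|.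
Proof.
apply: leq_trans (leq_card_setU _ _); apply/subset_leq_card/subsetP => y.
by rewrite !inE -andb_orr.
Qed.

Lemma degstar_adjdeg x : degstar D x <= adjdeg x [set: T].
Proof.
rewrite geq_max; apply/andP; split; apply/subset_leq_card/subsetP => y;
  by rewrite !inE /adj /= => ->; rewrite ?orbT.
Qed.

Lemma adjdegU x S S' : adjdeg x (S :|: S') <= adjdeg x S + adjdeg x S'.
Proof.
apply: leq_trans (leq_card_setU _ _); apply/subset_leq_card/subsetP => y.
by rewrite !inE andb_orl.
Qed.

Lemma adjdeg_le x S : adjdeg x S <= #|S|.
Proof. by apply/subset_leq_card/subsetP => y; rewrite inE => /andP[]. Qed.

(** In this form the sum over uncovered vertices can be exchanged with the sum over copies. *)
Lemma adjdeg_tiling l x (F : {set {ffun 'I_l -> T}}) :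
  adjdeg x (tiling_verts F) <= \sum_(phi in F) \sum_i adj D x (phi i).
Proof.
have card_bigcup (I : finType) (P : pred I) (A : I -> {set T}) :
    #|\bigcup_(i | P i) A i| <= \sum_(i | P i) #|A i|.
  apply: (big_rec2 (fun (B : {set T}) s => #|B| <= s)) => [|i s B _ le].
    by rewrite cards0.
  by apply: leq_trans (leq_card_setU _ _) _; rewrite leq_add2l.
have sub : [set y in tiling_verts F | adj D x y] \subset
    \bigcup_(phi in F) \bigcup_i [set y | (y == phi i) && adj D x y].
  apply/subsetP => y; rewrite inE.
  move=> /andP[/bigcupP[phi phiF /imsetP[i _ ->]] xy].
  apply/bigcupP; exists phi => //; apply/bigcupP; exists i => //.
  by rewrite inE eqxx.
apply: leq_trans (subset_leq_card sub) _.
apply: leq_trans (card_bigcup _ _ _) _; apply: leq_sum => phi _.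
apply: leq_trans (card_bigcup _ _ _) _; apply: leq_sum => i _.
case: (boolP (adj D x (phi i))) => xi.
  rewrite -[leqRHS](cards1 (phi i)); apply/subset_leq_card/subsetP => y.
  by rewrite !inE => /andP[].
by rewrite leqn0 cards_eq0 -subset0; apply/subsetP => y;
  rewrite inE => /andP[/eqP-> /idPn]; rewrite xi.
Qed.

End Degrees.

(** * Double counting between covered and uncovered vertices *)

Section AlmostPerfectTiling.
Local Open Scope nat_scope.
Variables (n : nat) (C : rel 'I_n.+3) (T : finType) (D : rel T).
Hypotheses (Corient : cycle_orientation C) (Cdir : ~ directed_cycle C).
Hypothesis Dirr : irreflexive D.

(** The first summand suffices for a path in a neighbourhood; the second pays for avoiding the
    vertices of one other copy. *)
Let h := n.+2 ^ 2 * (indep_num D).+1 + n.+3.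

Lemma copy_from_adjdeg (x : T) (S Y : {set T}) :
  2 * h <= adjdeg D x S -> #|Y| <= n.+3 ->
  exists2 phi : {ffun 'I_n.+3 -> T}, embedding C D phi &
    copy_verts phi \subset x |: (S :\: Y).
Proof.
move=> hx cY; have [b hb] : exists b, h <= #|[set y in S | arr b D x y]|.
  have := adjdeg_arr D x S.
  have [|lt1] := leqP h #|[set y in S | arr true D x y]|.
    by exists true.
  by exists false; lia.
apply: (copy_from_neighbours Corient Cdir Dirr (b := b)).
rewrite (_ : [set y in S :\: Y | _] = [set y in S | arr b D x y] :\: Y).
  have := subset_leq_card (subsetIr [set y in S | arr b D x y] Y).
  by rewrite cardsD; rewrite /h in hb; lia.
by apply/setP => y; rewrite !inE andbA.
Qed.

Lemma card_copy (phi : {ffun 'I_n.+3 -> T}) : #|copy_verts phi| <= n.+3.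
Proof. by rewrite (leq_trans (leq_imset_card _ _)) // card_ord. Qed.

(* Two vertices of one copy with many uncovered neighbours would allow to
   replace that copy by two. *)
Lemma uncovered_adjdeg (W : {set T}) : exists2 F : {set {ffun 'I_n.+3 -> T}},
  tiling C D W F & let L := W :\: tiling_verts F in
  (forall u, u \in L -> adjdeg D u L < 2 * h) /\
  (forall phi i j, phi \in F -> i != j ->
    2 * h <= adjdeg D (phi i) L -> adjdeg D (phi j) L < 2 * h).
Proof.
have [F tF maxF] := maximum_tiling C D W; exists F => // L.
have exch (F0 G : {set {ffun 'I_n.+3 -> T}}) : F0 \subset F ->
    tiling C D (L :|: tiling_verts F0) G -> #|G| <= #|F0|.
  move=> sF0 tG; have [tF' cF'] := tiling_exchange (ltn0Sn _) tF sF0 tG.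
  by have := maxF _ tF'; lia.
split=> [u uL|phi i j phiF neq_ij hi]; rewrite ltnNge; apply/negP.
  move=> hu; have [|psi emb sub] := copy_from_adjdeg (Y := set0) hu.
    by rewrite cards0.
  have := exch set0 [set psi] (sub0set _); rewrite cards1 cards0 => /(_ _)/negP.
  apply=> //.
  split=> [rho|rho|rho sigma]; rewrite ?inE => /eqP-> //.
    apply: subset_trans sub (subset_trans _ (subsetUl _ _)).
    by rewrite setD0 subUset sub1set uL subxx.
  by move=> /eqP->; rewrite eqxx.
move=> hj; have [|psi1 emb1 sub1] := copy_from_adjdeg (Y := set0) hi.
  by rewrite cards0.
have [psi2 emb2 sub2] := copy_from_adjdeg hj (card_copy psi1).
have phiV k : phi k \in tiling_verts F.
  by apply: (subsetP (copy_sub_tiling_verts phiF)); apply: mem_copy_verts.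
have phiL k : phi k \notin L by rewrite inE phiV.
(* By construction [psi2] avoids [psi1] except possibly at [phi j], which is covered by [F] and
   differs from [phi i]. *)
have dis : [disjoint copy_verts psi1 & copy_verts psi2].
  apply: disjointWr sub2 _; rewrite -setI_eq0; apply/eqP/setP => v.
  rewrite !inE; apply/negbTE/negP => /andP[v1 /orP[/eqP v2|]]; last first.
    by rewrite v1.
  have := subsetP sub1 _ v1; rewrite v2 setD0 in_setU1 (negPf (phiL _)) orbF.
  have [Femb _ _] := tF; move=> /eqP/(proj1 (Femb _ phiF)) eq_ji.
  by rewrite eq_ji eqxx in neq_ij.
have neq : psi1 != psi2.
  apply: contraTneq dis => ->; rewrite -setI_eq0 setIid.
  by apply/set0Pn; exists (psi2 ord0); apply: mem_copy_verts.
have := exch [set phi] [set psi1; psi2]; rewrite sub1set cards1 cards2 neq.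
move=> /(_ phiF _)/negP; apply=> //.
have sub k (S : {set T}) (psi : {ffun 'I_n.+3 -> T}) :
    copy_verts psi \subset phi k |: (L :\: S) ->
    copy_verts psi \subset L :|: tiling_verts [set phi].
  move/subset_trans; apply; rewrite subUset sub1set setUC inE.
  rewrite (subsetP (copy_sub_tiling_verts (set11 phi))) ?mem_copy_verts //=.
  exact: subset_trans (subsetDl _ _) (subsetUr _ _).
split=> [rho|rho|rho sigma]; rewrite !inE.
- by move=> /orP[] /eqP->.
- by move=> /orP[] /eqP->; [apply: sub sub1 | apply: sub sub2].
- by move=> /orP[] /eqP-> /orP[] /eqP->; rewrite ?eqxx // => _;
    rewrite disjoint_sym.
Qed.

Hypothesis Dore : forall x y : T, x != y -> ~~ adj D x y ->
  3 * #|T| <= 4 * (degstar D x + degstar D y).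

Lemma almost_perfect_tiling (W : {set T}) : 50 * #|~: W| <= #|T| ->
  exists2 F : {set {ffun 'I_n.+3 -> T}}, tiling C D W F &
    #|W :\: tiling_verts F| <= 220 * h.
Proof.
move=> cW; have [F tF [Llt Flt]] := uncovered_adjdeg W; exists F => //.
set L := W :\: _ in Llt Flt *.
(* In each copy, at most one vertex has many neighbours in [L], at most [#|L|] of them; every other
   vertex has fewer than [2 * h]. *)
have sum_tiling : \sum_(u in L) adjdeg D u (tiling_verts F) <=
    #|F| * (#|L| + n.+3 * (2 * h)).
  apply: (@leq_trans (\sum_(u in L) \sum_(phi in F) \sum_i adj D u (phi i))).
    by apply: leq_sum => u _; apply: adjdeg_tiling.
  rewrite exchange_big /= -sum_nat_const; apply: leq_sum => phi phiF.
  rewrite exchange_big /=.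
  have -> : \sum_i \sum_(u in L) adj D u (phi i) = \sum_i adjdeg D (phi i) L.
    apply: eq_bigr => i _; rewrite adjdeg_sum.
    by apply: eq_bigr => u _; rewrite /adj orbC.
  have le_light (P : pred 'I_n.+3) :
      (forall i, P i -> adjdeg D (phi i) L < 2 * h) ->
      \sum_(i | P i) adjdeg D (phi i) L <= n.+3 * (2 * h).
    move=> lt; apply: leq_trans (leq_sum _ (fun i Pi => ltnW (lt i Pi))) _.
    by rewrite sum_nat_const leq_mul2r (leq_trans (max_card _)) ?card_ord ?orbT.
  have [/existsP[i hi]|/existsPn light] :=
      boolP [exists i, 2 * h <= adjdeg D (phi i) L].
    rewrite (bigD1 i) //= leq_add ?adjdeg_le ?le_light // => j neq.
    by apply: Flt hi; rewrite // eq_sym.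
  by apply: leq_trans (leq_addl _ _); apply: le_light => i _; rewrite ltnNge.
(* By the Ore condition two vertices of [L] outside [Lg] are adjacent, so they all lie in the closed
   neighbourhood of one of them, which has at most [2 * h] vertices in [L]. *)
pose Lg := [set u in L | 3 * #|T| <= 8 * degstar D u].
have LgS : #|L| <= #|Lg| + 2 * h.
  rewrite -(cardsID Lg L) leq_add ?subset_leq_card ?subsetIr //.
  have [->|[v /setDP[vL]]] := set_0Vmem (L :\: Lg); first by rewrite cards0.
  rewrite inE vL /= => vg.
  have : #|L :\: Lg| <= #|v |: [set y in L | adj D v y]|.
    apply/subset_leq_card/subsetP => y /setDP[yL]; rewrite inE yL /= => yg.
    rewrite in_setU1 inE yL; have [//|neq] := eqVneq y v; rewrite /=.
    apply: contraT => nadj; rewrite eq_sym in neq.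
    by move: vg yg (Dore neq nadj) => /=; lia.
  have := Llt v vL; rewrite cardsU1 /adjdeg; lia.
have deg_good u : u \in Lg ->
    3 * #|T| <= 8 * (adjdeg D u (tiling_verts F) + #|~: W| + 2 * h).
  rewrite inE => /andP[uL /leq_trans]; apply; rewrite leq_mul2l /=.
  apply: leq_trans (degstar_adjdeg D u) _.
  have -> : [set: T] = tiling_verts F :|: ~: W :|: L.
    apply/setP => y; rewrite !inE.
    by case: (y \in tiling_verts F); case: (y \in W).
  apply: leq_trans (adjdegU _ _ _ _) _.
  apply: leq_add; last exact: ltnW (Llt u uL).
  by apply: leq_trans (adjdegU _ _ _ _) _; rewrite leq_add2l adjdeg_le.
have sum_good : #|Lg| * (3 * #|T|) <=
    8 * (#|F| * (#|L| + n.+3 * (2 * h)) + #|L| * (#|~: W| + 2 * h)).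
  have sLg : Lg \subset L by apply/subsetP => u; rewrite inE => /andP[].
  rewrite -sum_nat_const; apply: leq_trans (leq_sum _ deg_good) _.
  rewrite -big_distrr leq_mul2l /=.
  under eq_bigr do rewrite -addnA.
  rewrite big_split sum_nat_const leq_add ?leq_mul ?subset_leq_card //=.
  apply: leq_trans sum_tiling; rewrite [leqRHS](big_setID Lg) /= (setIidPr sLg).
  exact: leq_addr.
have cF := card_tiling tF.
have cLT : #|L| <= #|T| by apply: max_card.
have [T0|T0] := posnP #|T|; first by lia.
rewrite -(leq_pmul2l T0).
have FL : 3 * (#|F| * #|L|) <= #|T| * #|L| by nia.
have Fh : #|F| * (n.+3 * (2 * h)) <= 2 * (#|T| * h) by nia.
have LW : 50 * (#|L| * #|~: W|) <= #|T| * #|L| by nia.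
have Lh : #|L| * h <= #|T| * h by nia.
have LgT : #|T| * #|L| <= #|Lg| * #|T| + 2 * (#|T| * h) by nia.
(* After division by [#|T|] the bounds give 3|L| <= (8/3 + 8/50)|L| + 38h, that is 13|L| <= 2850h,
   whence the constant 220. *)
rewrite mulnDr mulnDr !mulnDr in sum_good; lia.
Qed.

End AlmostPerfectTiling.

(** * Choice of the constants *)

Theorem theorem3p8 (R : realType) :
  exists (phi_eta phi_d : R -> R) (phi_eps : R -> R -> R -> R),
  [/\ forall x, 0 < x -> 0 < phi_eta x,
      forall x, 0 < x -> 0 < phi_d x &
      forall x y z, 0 < x -> 0 < y -> 0 < z -> 0 < phi_eps x y z] /\
  forall (l : nat) (C : rel 'I_l) (mu eta d eps : R) (M0 M : nat) (xi : R),
    (3 <= l)%N -> cycle_orientation C -> ~ directed_cycle C ->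
    0 < mu <= 10 ^- 2 ->
    0 < eta <= phi_eta mu ->
    0 < d <= phi_d (mu ^+ 2) ->
    0 < eps <= phi_eps (d ^+ 4) (mu ^+ 2) (1 / l%:R) ->
    (3 < M0)%N -> (M0 <= M)%N ->
    0 < xi ->
  exists2 gamma0 : R, 0 < gamma0 &
  forall gamma : R, 0 < gamma <= gamma0 ->
  exists n0 : nat,
  forall (T : finType) (D : rel T),
    (n0 <= #|T|)%N ->
    oriented D ->
    (((3 / 4 + mu) * #|T|%:R)%:E <= sigma_ore R D)%E ->
    (indep_num D)%:R <= gamma * #|T|%:R ->
  forall (k m : nat) (V0 : {set T}) (V : 'I_k -> {set T}) (D' : rel T)
         (f : 'I_k -> 'I_k) (FE : {set {ffun 'I_l -> T}}) (A : {set T}),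
    regularity_partition D eps d M0 M m V0 V D' ->
    partner_map D d V D' f ->
    exceptional_tiling C D eps m V (bad_set D eps m V0 V D' f) FE ->
    let VD1 := ~: tiling_verts FE in
    A \subset VD1 ->
    #|A|%:R <= eta * #|T|%:R ->
    let VD2 := VD1 :\: A in
  exists F : {set {ffun 'I_l -> T}},
    tiling C D VD2 F /\
    #|VD2 :\: tiling_verts F|%:R <= xi * #|T|%:R.
Proof.
(* With [eta] and the square root of [eps] at most 1/100, the sets [A] and [tiling_verts FE]
   together take up at most 1/50 of the vertices. *)
exists (fun=> 1 / 100), (fun=> 1), (fun _ _ _ => (1 / 100) ^+ 2); split.
  by split=> *; rewrite ?exprn_gt0 ?divr_gt0 ?ltr01 ?ltr0n.
move=> [|[|[|n]]] // C mu eta d eps M0 M xi _ Corient Cdir /andP[mu0 _].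
move=> /andP[eta0 eta_le] _ /andP[eps0 eps_le] _ _ xi0.
set q : R := (n.+2 ^ 2)%:R.
set r : R := n.+3%:R.
have q0 : 0 < q by rewrite ltr0n.
have r0 : 0 < r by rewrite ltr0n.
(* The uncovered part is at most 220(q(alpha + 1) + r). This [gamma] bounds the share 220 q alpha by
   half of xi n, and the choice of [n0] bounds the constant share 220(q + r) by the other half. *)
exists (xi / (440 * q)) => [|gamma /andP[gamma0 gamma_le]].
  by rewrite divr_gt0 // mulr_gt0.
exists (Num.bound (440 * (q + r) / xi)) => T D leT [Dirr _] ore alpha.
move=> k m V0 V D' f FE A _ _ [_ _ _ cFE FE1 FE2 _] VD1 _ cA VD2.
have Dore (x y : T) : x != y -> ~~ adj D x y ->
    (3 * #|T| <= 4 * (degstar D x + degstar D y))%N.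
  move=> neq; rewrite /adj negb_or => /andP[xy yx].
  have /(le_trans ore) :
      (sigma_ore R D <= ((degstar D x + degstar D y)%:R)%:E)%E.
    apply: (@Order.TotalTheory.bigmin_le_cond _ _ _ _ (x, y)).
    by rewrite /= neq xy yx.
  rewrite lee_fin -(ler_nat R) !natrM => le_sum.
  have : 0 <= mu * #|T|%:R by rewrite mulr_ge0 // ltW.
  by lra.
have sqrt_eps : Num.sqrt eps <= 1 / 100.
  by rewrite -[leRHS]ger0_norm ?divr_ge0 -?sqrtr_sqr ?ler_wsqrtr.
have [F tF cF] : exists2 F, tiling C D VD2 F & (#|VD2 :\: tiling_verts F| <=
    220 * (n.+2 ^ 2 * (indep_num D).+1 + n.+3))%N.
  apply: almost_perfect_tiling => //.
  rewrite -(ler_nat R) natrM setCD setCK.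
  have := (leq_card_setU (tiling_verts FE) A).1; rewrite -(ler_nat R) natrD.
  have : #|tiling_verts FE|%:R <= 1 / 100 * #|T|%:R :> R.
    rewrite cFE (le_trans FE1) // (le_trans FE2) //.
    by rewrite ler_wpM2r.
  have : eta * #|T|%:R <= 1 / 100 * #|T|%:R by rewrite ler_wpM2r.
  by move: cA; lra.
exists F; split=> //.
move: cF; rewrite -(ler_nat R) natrM natrD natrM -/q -/r.
rewrite -[(indep_num D).+1%:R]natr1 => /le_trans; apply.
have big : 440 * (q + r) <= xi * #|T|%:R.
  rewrite [leRHS]mulrC -ler_pdivrMr //; apply: ltW.
  apply: lt_le_trans (archi_boundP _) _; last by rewrite ler_nat.
  by rewrite ltW // divr_gt0 // mulr_gt0 // addr_gt0.
have small : 440 * (q * (indep_num D)%:R) <= xi * #|T|%:R.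
  apply: (@le_trans _ _ (440 * (q * (gamma * #|T|%:R)))).
    by rewrite ler_wpM2l // ler_wpM2l // ltW.
  rewrite !mulrA ler_wpM2r // mulrC -ler_pdivlMr //.
  by rewrite mulr_gt0.
by clearbody q r; clear -big small; rewrite [q * _]mulrDr mulr1; lra.
Qed.
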